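(* Let $\sigma$ and $\theta$ be finite substitutions. Then (1) $\sigma$ is a regular extension of $\sigma|_{\mathrm{ker}(\sigma)}$; (2) if $\sigma\preceq\theta$, then $\mathrm{ker}(\sigma)\supseteq\mathrm{ker}(\theta)$; (3) if $\sigma\approx\theta$, then $\mathrm{ker}(\sigma)=\mathrm{ker}(\theta)$.
   Context: $L$ is a first-order language with equality; $\mathit{Var}$ is the set of variables. A finite substitution $\sigma$ maps a finite set $\mathrm{Dom}(\sigma)$ of variables to terms of $L$; $\mathrm{Range}(\sigma)$ is the set of variables occurring in its values; $t\sigma$ is simultaneous replacement; composition $\sigma\tau$ (when $\mathrm{Range}(\sigma)\subseteq\mathrm{Dom}(\tau)$) has $(\sigma\tau)(x)=\sigma(x)\tau$ for $x\in\mathrm{Dom}(\sigma)$. $\sigma|_X$ is the restriction of $\sigma$ to $\mathrm{Dom}(\sigma)\cap X$. $\theta$ is a regular extension of $\sigma$ if $\mathrm{Dom}(\sigma)\subseteq\mathrm{Dom}(\theta)$, $\theta$ agrees with $\sigma$ on $\mathrm{Dom}(\sigma)$, and $\theta$ maps $\mathrm{Dom}(\theta)\setminus\mathrm{Dom}(\sigma)$ injectively into variables not in $\mathrm{Range}(\sigma)$. $\sigma\preceq\theta$ iff there is $\tau$ with $\sigma'=\theta'\tau$ for some regular extensions $\sigma'$ of $\sigma$ and $\theta'$ of $\theta$ with the same domain; $\sigma\approx\theta$ iff $\sigma\preceq\theta$ and $\theta\preceq\sigma$. The kernel of $\sigma$ is $\mathrm{ker}(\sigma)=\bigcap\{X\subseteq\mathit{Var}:\sigma|_X\approx\sigma\}$.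 *)

(* Defs.v *)
From HB Require Import structures.
From mathcomp Require Import all_boot finmap all_classical.

Set Implicit Arguments.
Unset Strict Implicit.
Unset Printing Implicit Defensive.

Local Open Scope fset_scope.
Local Open Scope fmap_scope.

(* Equality is a logical symbol, hence it is not listed among [rel_sym]. *)
Record language := Language {
  var : choiceType;
  var_infinite : infinite_set [set: var];
  func_sym : Type;
  func_arity : func_sym -> nat;
  rel_sym : Type;
  rel_arity : rel_sym -> nat
}.

Inductive term (L : language) : Type :=
| Var of var L
| App (f : func_sym L) of term L ^ func_arity f.

Definition substitution (L : language) : Type := {fmap var L -> term L}.

Fixpoint term_vars (L : language) (t : term L) : {fset var L} :=
  match t with
  | Var x => [fset x]
  | App f args => \big[fsetU/fset0]_(i < func_arity f) term_vars (args i)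
  end.

Definition range_vars (L : language) (s : substitution L) : {fset var L} :=
  \big[fsetU/fset0]_(x : domf s) term_vars (s x).

(* Variables outside the domain are left unchanged; this never matters in
   [preceq], where the range of the first factor of a composition is required
   to be included in the domain of the second. *)
Fixpoint subst (L : language) (s : substitution L) (t : term L) : term L :=
  match t with
  | Var x => odflt (Var x) s.[? x]
  | App f args => App [ffun i => subst s (args i)]
  end.

Definition subst_comp (L : language) (s t : substitution L) : substitution L :=
  [fmap x : domf s => subst t (s x)].

Definition subst_restrict (L : language) (s : substitution L)
    (X : set (var L)) : substitution L :=
  s.[& [fset x in domf s | x \in X]].

Definition regular_extension (L : language) (s t : substitution L) : Prop :=
  [/\ domf s `<=` domf t,
      forall x, x \in domf s -> t.[? x] = s.[? x],
      forall x, x \in domf t `\` domf s ->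
        exists2 y, t.[? x] = Some (Var y) & y \notin range_vars s
    & {in domf t `\` domf s &, forall x y, t.[? x] = t.[? y] -> x = y}].

Definition preceq (L : language) (s t : substitution L) : Prop :=
  exists s' t' r : substitution L,
    [/\ regular_extension s s', regular_extension t t', domf s' = domf t',
        range_vars t' `<=` domf r & s' = subst_comp t' r].

Definition approx (L : language) (s t : substitution L) : Prop :=
  preceq s t /\ preceq t s.

Definition kernel (L : language) (s : substitution L) : set (var L) :=
  (\bigcap_(X in [set X | approx (subst_restrict s X) s]) X)%classic.

(* Main.v *)
Require Import Defs.
From mathcomp Require Import all_boot finmap all_classical.

(** The complement of ker(s) consists of the variables x that are "isolated" in
    s: either x is outside Dom(s), or s(x) is a variable occurring in no other
    value of s.  If s is below t and x is isolated in s, then x is isolated in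
    t: write s' = t' r; as s'(x) is a variable y, so is t'(x) = u, and an
    occurrence of u in t'(z) would yield an occurrence of y in s'(z).  If x is
    not in X, then x is vacuously isolated in s|_X, so s|_X below s already
    makes x isolated in s.  Conversely, if x is isolated in s, then s is a
    regular extension of its restriction to the variables other than x. *)

Set Implicit Arguments.
Unset Strict Implicit.
Unset Printing Implicit Defensive.

Local Open Scope fset_scope.
Local Open Scope fmap_scope.

(* The generated [term_ind] has no induction hypothesis for the arguments. *)
Lemma term_args_ind (L : language) (P : term L -> Prop) :
  (forall x, P (Var x)) ->
  (forall f (args : term L ^ func_arity f), (forall i, P (args i)) ->
    P (App args)) ->
  forall t, P t.
Proof.
move=> PVar PApp; fix IH 1; case=> [x|f args]; first exact: PVar.
by apply: PApp => i; apply: IH.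
Qed.

Lemma term_vars_AppP (L : language) (f : func_sym L)
    (args : term L ^ func_arity f) x :
  reflect (exists i, x \in term_vars (args i)) (x \in term_vars (App args)).
Proof.
apply: (iffP (bigfcupP _ _ _ _)) => [[i _ xi]|[i xi]]; first by exists i.
by exists i; rewrite ?mem_index_enum.
Qed.

Lemma range_varsP (L : language) (s : substitution L) y :
  reflect (exists x t, s.[? x] = Some t /\ y \in term_vars t)
          (y \in range_vars s).
Proof.
apply: (iffP (bigfcupP _ _ _ _)) => [[x _ ys]|[x [t [sx yt]]]].
  by exists (val x), (s x); rewrite Some_fnd.
case: fndP sx => // xs [sx].
by exists [` xs]; rewrite ?mem_index_enum // sx.
Qed.

Lemma fnd_subst_comp (L : language) (s t : substitution L) x :
  (subst_comp s t).[? x] = omap (subst t) s.[? x].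
Proof.
have [xs|xs] := boolP (x \in domf s); last by rewrite !not_fnd.
by rewrite (in_fnd xs) (@in_fnd _ _ (subst_comp s t) _ xs) ffunE.
Qed.

Lemma mem_subst_restrict (L : language) (s : substitution L) X x :
  (x \in domf (subst_restrict s X)) = (x \in domf s) && (x \in X).
Proof. by rewrite /subst_restrict domf_restrict !inE andbC andbA andbb. Qed.

Lemma fnd_subst_restrict (L : language) (s : substitution L) X x :
  (subst_restrict s X).[? x] = if x \in X then s.[? x] else None.
Proof.
rewrite /subst_restrict fnd_restrict !inE.
by case: (fndP s x) => [xs|xs]; case: ifP => //=; case: ifP.
Qed.

(** Every occurrence of [u] in [t] turns into an occurrence of [y]. Phrasing the hypothesis through
    [subst] also covers [u] outside the domain, where [y] is [u]. *)
Lemma term_vars_subst (L : language) (s : substitution L) u y t :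
  subst s (Var u) = Var y -> u \in term_vars t ->
  y \in term_vars (subst s t).
Proof.
move=> su; elim/term_args_ind: t => [x|f args IH].
  by move=> /fset1P <-; rewrite su; apply/fset1P.
case/term_vars_AppP => i ui; apply/term_vars_AppP.
by exists i; rewrite ffunE; apply: IH.
Qed.

Lemma subst_id (L : language) (s : substitution L) t :
  (forall x, x \in term_vars t -> subst s (Var x) = Var x) -> subst s t = t.
Proof.
elim/term_args_ind: t => [x sx|f args IH sargs]; first by apply: sx; rewrite inE.
rewrite /=; congr App; apply/ffunP => i; rewrite ffunE.
by apply: IH => x xi; apply: sargs; apply/term_vars_AppP; exists i.
Qed.

Lemma subst_comp_id (L : language) (s : substitution L) :
  exists2 r : substitution L, range_vars s `<=` domf r & s = subst_comp s r.
Proof.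
(* The identity on exactly [range_vars s] meets the range condition of [preceq]. *)
pose r : substitution L := [fmap x : range_vars s => Var (val x)].
exists r; first exact: fsubset_refl.
apply/fmapP => x; rewrite fnd_subst_comp.
case sx: s.[? x] => [t|] //=; rewrite subst_id // => y yt.
have ys : y \in range_vars s by apply/range_varsP; exists x, t.
have yr : y \in domf r by [].
by rewrite /= (in_fnd yr) ffunE.
Qed.

Lemma regular_extension_refl (L : language) (s : substitution L) :
  regular_extension s s.
Proof. by split=> // [x|x y]; rewrite fsetDv inE. Qed.

(** [t] regularly extends both [s] and itself, so it serves as the common extension in both
    directions, with an identity factor. *)
Lemma regular_extension_approx (L : language) (s t : substitution L) :
  regular_extension s t -> approx s t.
Proof.
move=> st; have [r tr def_t] := subst_comp_id t.
have tt := regular_extension_refl t.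
by split; exists t, t, r.
Qed.

Definition isolated (L : language) (s : substitution L) (x : var L) : Prop :=
  x \in domf s -> exists2 y, s.[? x] = Some (Var y) &
    forall z t, z != x -> s.[? z] = Some t -> y \notin term_vars t.

Lemma fnd_mem_domf (L : language) (s : substitution L) x t :
  s.[? x] = Some t -> x \in domf s.
Proof. by rewrite -fndSome => ->. Qed.

(** Added values are variables outside [range_vars s], so they never meet an old value; injectivity
    keeps them apart from one another. The four cases are [x] and [z] old or new. *)
Lemma isolated_regular_extension (L : language) (s s' : substitution L) x :
  regular_extension s s' -> isolated s x -> isolated s' x.
Proof.
case=> _ old new inj iso xs'.
have [xs|xNs] := boolP (x \in domf s).
  have [y sx yiso] := iso xs; exists y; first by rewrite old.
  move=> z t zx s'z; have zs' := fnd_mem_domf s'z.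
  have [zs|zNs] := boolP (z \in domf s).
    by apply: yiso zx _; rewrite -old.
  have [|w s'w wNs] := new z; first by rewrite inE zNs.
  move: s'z; rewrite s'w => -[<-]; rewrite inE.
  apply: contraNneq wNs => <-; apply/range_varsP.
  by exists x, (Var y); rewrite sx inE.
have xD : x \in domf s' `\` domf s by rewrite inE xNs.
have [y s'x yNs] := new x xD; exists y => // z t zx s'z.
have zs' := fnd_mem_domf s'z.
have [zs|zNs] := boolP (z \in domf s).
  apply: contra yNs => yt; apply/range_varsP; exists z, t.
  by rewrite -old.
have zD : z \in domf s' `\` domf s by rewrite inE zNs.
have [w s'w _] := new z zD.
move: s'z; rewrite s'w => -[<-]; rewrite inE.
by apply: contraNneq zx => yw; apply/eqP/inj; rewrite // s'w s'x yw.
Qed.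

(** Passing to the smaller substitution only removes terms in which [y] might occur. *)
Lemma isolated_restrict_regular (L : language) (s s' : substitution L) x :
  regular_extension s s' -> isolated s' x -> isolated s x.
Proof.
case=> ss' old _ _ iso xs.
have [y s'x yiso] := iso (fsubsetP ss' _ xs).
exists y; first by rewrite -old.
by move=> z t zx sz; apply: yiso zx _; rewrite old // (fnd_mem_domf sz).
Qed.

Lemma isolated_subst_comp (L : language) (t r : substitution L) x :
  isolated (subst_comp t r) x -> isolated t x.
Proof.
move=> iso xt; have [y] := iso xt.
(* Substitution preserves a head function symbol, so a variable as value of the composition forces
   [t] to map [x] to a variable [u]. *)
rewrite fnd_subst_comp; case tx: t.[? x] => [[u|f args]|] //= -[ru] yiso.
exists u => // z v zx tz; apply: contra (yiso z (subst r v) zx _).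
  exact: term_vars_subst.
by rewrite fnd_subst_comp tz.
Qed.

Lemma isolated_preceq (L : language) (s t : substitution L) x :
  preceq s t -> isolated s x -> isolated t x.
Proof.
case=> s' [t' [r [ss' tt' _ _ def_s']]] iso.
apply: (isolated_restrict_regular tt'); apply: (@isolated_subst_comp _ _ r).
by rewrite -def_s'; apply: isolated_regular_extension iso.
Qed.

(** The value of a removed variable occurs in no other value, hence not in the range of what is
    kept. [X] is arbitrary so that one variable, or all isolated ones at once, can be removed. *)
Lemma isolated_regular_restrict (L : language) (s : substitution L) X :
  (forall x, x \notin X -> isolated s x) ->
  regular_extension (subst_restrict s X) s.
Proof.
move=> iso.
have newP x : x \in domf s `\` domf (subst_restrict s X) ->
    (x \in domf s) /\ (x \notin X).
  by rewrite inE mem_subst_restrict => /andP[/nandP[/negP|] xX xs].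
split.
- by apply/fsubsetP => x; rewrite mem_subst_restrict => /andP[].
- move=> x; rewrite mem_subst_restrict fnd_subst_restrict.
  by case/andP=> _ ->.
- move=> x /newP[xs xX]; have [y sx yiso] := iso x xX xs; exists y => //.
  apply/range_varsP => -[z [t []]]; rewrite fnd_subst_restrict.
  case: ifPn => // zX sz; apply/negP; apply: yiso sz.
  by apply: contraNneq xX => <-.
(* Were [z] different from [x], the variable [y] would occur in the value at [z], against the
   isolation of [x]. *)
move=> x z /newP[xs xX] /newP[zs zX] sxz; apply/eqP.
have [y sx yiso] := iso x xX xs; rewrite eq_sym.
apply/negPn/negP => zx; have := yiso z (Var y) zx.
by rewrite -sxz inE eqxx => /(_ sx).
Qed.

Lemma notin_kernelP (L : language) (s : substitution L) x :
  ~ kernel s x <-> isolated s x.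
Proof.
split=> [xNker|iso].
  (* If [x] is not isolated, every [X] in the intersected family must contain it. *)
  apply: contrapT => xNiso; apply: xNker => X [Xs _].
  apply: contrapT => xNX; apply: xNiso; apply: (isolated_preceq Xs).
  by rewrite /isolated mem_subst_restrict => /andP[_ /set_mem].
(* The complement of [x] alone is a member of the family that witnesses the exclusion of [x] from
   the intersection. *)
move=> /(_ [set z | z != x]%classic) /=; rewrite eqxx.
suff rs: regular_extension (subst_restrict s [set z | z != x]%classic) s.
  by move/(_ (regular_extension_approx rs)).
apply: isolated_regular_restrict => z.
by rewrite notin_setE /= => /negP/negPn/eqP ->.
Qed.

Lemma kernel_preceq (L : language) (s t : substitution L) :
  preceq s t -> (kernel t `<=` kernel s)%classic.
Proof.
move=> st x xt; apply: contrapT => /notin_kernelP /(isolated_preceq st).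
by move/notin_kernelP.
Qed.

Theorem theorem5p13 (L : language) (sigma theta : substitution L) :
  regular_extension (subst_restrict sigma (kernel sigma)) sigma /\
  (preceq sigma theta -> (kernel theta `<=` kernel sigma)%classic) /\
  (approx sigma theta -> kernel sigma = kernel theta).
Proof.
split; [|split].
- apply: isolated_regular_restrict => x; rewrite notin_setE.
  by move/notin_kernelP.
- exact: kernel_preceq.
- by case=> st ts; apply/seteqP; split; apply: kernel_preceq.
Qed.
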